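(* The gate complexity of ${\sf MAJ}\circ{\sf MAJ}$ circuits that agree with PARITY on $99\%$ of all $n$-bit inputs is $\Theta(\sqrt{n})$, and their wire complexity is $\Theta(n^{3/2})$. Moreover, the lower bounds (every circuit agreeing with PARITY on $99\%$ of inputs has $\Omega(\sqrt n)$ gates and $\Omega(n^{3/2})$ wires) hold even for ${\sf LTF}\circ{\sf LTF}$ circuits.
   Context: PARITY$(x)=\sum_i x_i \bmod 2$. An LTF outputs $1$ iff a real-weighted sum of its inputs is at least a real threshold. An ${\sf LTF}\circ{\sf LTF}$ circuit is a layer of LTF gates (arbitrary real weights) on the input variables feeding, possibly together with input variables, a single output LTF gate. A ${\sf MAJ}\circ{\sf MAJ}$ circuit is such a circuit in which all gates are MAJORITY gates (with negations allowed; equivalently LTFs with integer weights of magnitude polynomial in $n$). Gates are counted as LTF gates; wires are input connections of gates. *)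

(* Defs.v *)
From mathcomp Require Import all_boot all_order all_algebra.
From mathcomp Require Import all_classical all_reals all_analysis.
Import Order.TTheory GRing.Theory Num.Theory.
Import numFieldNormedType.Exports.

Set Implicit Arguments.
Unset Strict Implicit.
Unset Printing Implicit Defensive.

(* A kind of gate: for each finite type [I] of nodes it may read from, the
   gates over [I], the Boolean function each computes, and the number of input
   connections (wires) of each. *)
Record gate_class := GateClass {
  gate : finType -> Type;
  gate_eval : forall I : finType, gate I -> (I -> bool) -> bool;
  gate_wires : forall I : finType, gate I -> nat }.

Record ltf_gate (R : realType) (I : finType) := LtfGate {
  ltf_weight : I -> R;
  ltf_threshold : R }.

(* An input of weight 0 is not connected to the gate. *)
Definition LTF (R : realType) : gate_class := @GateClass (ltf_gate R)
  (fun I g x =>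
     (ltf_threshold g <= \sum_(i : I) ltf_weight g i * (x i)%:R)%R)
  (fun I g => #|[set i : I | ltf_weight g i != 0%R]|).

(* [(Some i, b)] stands for the input [x i], negated when [b] is true;
   [(None, b)] stands for the constant [b]. *)
Definition signed_value (I : finType) (x : I -> bool) (a : option I * bool) :
    bool :=
  (if a.1 is Some i then x i else false) (+) a.2.

(* The list of the connections of a MAJORITY gate. A connection may be repeated,
   which amounts to an integer weight, but at most [B] times. Constant inputs
   move the threshold; they are counted as wires. *)
Record maj_gate (B : nat) (I : finType) := MajGate {
  maj_inputs : seq (option I * bool);
  maj_mult : forall a, (count_mem a maj_inputs <= B)%N }.

Definition MAJ (B : nat) : gate_class := @GateClass (maj_gate B)
  (fun I g x =>
     (size (maj_inputs g) <= 2 * count (signed_value x) (maj_inputs g))%N)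
  (fun I g => size (maj_inputs g)).

(* Depth-two circuits on [n] variables; the output gate reads from the
   variables and from the gates of the bottom layer. *)
Record circuit2 (G : gate_class) (n : nat) := Circuit2 {
  bottom_size : nat;
  bottom_gate : 'I_bottom_size -> gate G 'I_n;
  top_gate : gate G ('I_n + 'I_bottom_size)%type }.

Arguments bottom_gate {G n} C j : rename.
Arguments top_gate {G n} C : rename.

Definition circuit2_eval (G : gate_class) (n : nat) (C : circuit2 G n)
    (x : 'I_n -> bool) : bool :=
  gate_eval (top_gate C) (fun v => match v with
    | inl i => x i
    | inr j => gate_eval (bottom_gate C j) x
    end).

Definition gates (G : gate_class) (n : nat) (C : circuit2 G n) : nat :=
  (bottom_size C).+1.

Definition wires (G : gate_class) (n : nat) (C : circuit2 G n) : nat :=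
  (\sum_(j < bottom_size C) gate_wires (bottom_gate C j) + gate_wires (top_gate C))%N.

Definition parity (n : nat) (x : 'I_n -> bool) : bool :=
  odd (\sum_(i < n) x i)%N.

Definition agrees99 (n : nat) (f : ('I_n -> bool) -> bool) : Prop :=
  (99 * #|{: {ffun 'I_n -> bool}}| <=
   100 * #|[set x : {ffun 'I_n -> bool} | f x == parity x]|)%N.

(* The least gate (wire) count of a circuit agreeing with parity on 99% of the
   inputs. If there were no such circuit this would be [inf set0 = 0]. *)
Definition gate_complexity (R : realType) (G : gate_class) (n : nat) : R :=
  inf [set (gates C)%:R%R | C in
       [set C : circuit2 G n | agrees99 (circuit2_eval C)]]%classic.

Definition wire_complexity (R : realType) (G : gate_class) (n : nat) : R :=
  inf [set (wires C)%:R%R | C in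
       [set C : circuit2 G n | agrees99 (circuit2_eval C)]]%classic.

(* Main.v *)
Require Import Defs.
From mathcomp Require Import all_boot all_order all_algebra.
From mathcomp Require Import all_classical all_reals all_analysis.
From mathcomp Require Import lra ring zify.
Import Order.TTheory GRing.Theory Num.Theory.
Import numFieldNormedType.Exports.
Local Open Scope classical_set_scope.
Local Open Scope ring_scope.

Set Implicit Arguments.
Unset Strict Implicit.
Unset Printing Implicit Defensive.

(* Lower bounds. Take [x] and directions [i <> j] at random and look at the
   subcube {x, x^i, x^j, x^ij}. If every bottom gate [g] satisfies
   g(x) + g(x^ij) = g(x^i) + g(x^j), then so does the weighted sum of the output
   gate, which therefore does not compute the XOR that parity induces on the
   subcube: one of the four points is an error. A gate violates the identity only
   if it reads [x i] and is sensitive to [x j] at [x] or [x^i]; as an LTF is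
   unate, its total sensitivity is a correlation with a Rademacher sum, so it is
   O(sqrt n 2^n) by Cauchy-Schwarz. Hence a gate with [w] wires spoils
   O(w sqrt n 2^n) of the n(n-1)2^n subcubes, and the bottom layer needs
   Omega(n^(3/2)) wires, thus also Omega(sqrt n) gates.

   Upper bounds. By Chebyshev 99% of the inputs have weight in a window of width
   O(sqrt n); there parity is an alternating sum of the gates [|x| >= k]. *)

(** * Flips of the Boolean cube and orthogonality of signs *)

Definition flip (I : finType) (i : I) (x : {ffun I -> bool}) :
    {ffun I -> bool} :=
  [ffun k => x k (+) (k == i)].

Lemma flip_neq (I : finType) (i k : I) (x : {ffun I -> bool}) :
  k != i -> flip i x k = x k.
Proof. by move=> /negPf ki; rewrite ffunE ki addbF. Qed.

Lemma flip_eq (I : finType) (i : I) (x : {ffun I -> bool}) :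
  flip i x i = ~~ x i.
Proof. by rewrite ffunE eqxx addbT. Qed.

Lemma flipK (I : finType) (i : I) : involutive (@flip I i).
Proof. by move=> x; apply/ffunP=> k; rewrite !ffunE -addbA addbb addbF. Qed.

Lemma flipC (I : finType) (i j : I) (x : {ffun I -> bool}) :
  flip i (flip j x) = flip j (flip i x).
Proof. by apply/ffunP=> k; rewrite !ffunE addbAC. Qed.

Lemma sum_flip (V : nmodType) (I : finType) (i : I)
    (F : {ffun I -> bool} -> V) :
  \sum_x F (flip i x) = \sum_x F x.
Proof. by rewrite [RHS](reindex_inj (inv_inj (@flipK I i))). Qed.

(** Parseval: flipping coordinate [i] negates the cross term of [i] and [j != i], so its sum over
    the cube equals its own opposite and only the diagonal survives. *)
Lemma sum_sign_sqr (R : numDomainType) (I : finType) (a : I -> R) :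
  \sum_(x : {ffun I -> bool}) (\sum_i a i * (-1) ^+ x i) ^+ 2
    = 2 ^+ #|I| * \sum_i a i ^+ 2.
Proof.
pose T i j := \sum_(x : {ffun I -> bool})
  a i * (-1) ^+ x i * (a j * (-1) ^+ x j).
have T_diag i : T i i = 2 ^+ #|I| * a i ^+ 2.
  rewrite /T (eq_bigr (fun=> a i ^+ 2)); last first.
    move=> x _; rewrite mulrACA -expr2 -expr2 -exprM mulnC exprM sqrrN expr1n.
    by rewrite expr1n mulr1.
  by rewrite sumr_const card_ffun card_bool -[LHS]mulr_natl natrX.
have T_off i j : j != i -> T i j = 0.
  move=> ji; apply/eqP; rewrite -eqNr; apply/eqP.
  rewrite /T -[RHS](sum_flip i) -sumrN; apply: eq_bigr => x _.
  by rewrite flip_eq (flip_neq _ ji) signrN mulrN mulNr.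
under eq_bigr => x _ do rewrite expr2 big_distrlr /=.
rewrite exchange_big mulr_sumr; apply: eq_bigr => i _.
rewrite exchange_big (bigD1 i) //= -/(T i i) T_diag big1 ?addr0 // => j.
exact: T_off.
Qed.

(** * Total sensitivity of threshold gates *)

Lemma ltf_sum_flip (R : realType) (I : finType) (w : I -> R) (j : I)
    (x : {ffun I -> bool}) :
  \sum_i w i * (flip j x i)%:R
    = \sum_i w i * (x i)%:R + w j * (-1) ^+ x j.
Proof.
rewrite (bigD1 j) //= [in RHS](bigD1 j) //= flip_eq.
rewrite (eq_bigr (fun i => w i * (x i)%:R)); last first.
  by move=> i ij; rewrite flip_neq.
by case: (x j) => /=; rewrite ?expr0 ?expr1 ?mulrN ?mulr0 ?mulr1; ring.
Qed.

(* Threshold gates are unate: flipping input [j] moves the weighted sum in the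
   direction of the sign of its weight. *)
Lemma ltf_sensitive_sign (R : realType) (I : finType) (g : gate (LTF R) I)
    (j : I) (x : {ffun I -> bool}) :
  (gate_eval g x != gate_eval g (flip j x))%:R
    = ((gate_eval g x)%:R - (gate_eval g (flip j x))%:R)
      * ((-1) ^+ (0 <= ltf_weight g j)%R * (-1) ^+ x j) :> R.
Proof.
rewrite /= ltf_sum_flip.
set s := \sum_(i : I) _; set t := ltf_threshold g; set w := ltf_weight g j.
case: (x j); case: (lerP 0 w) => wj; rewrite /= ?expr0 ?expr1 ?mulN1r ?mulr1;
  case: (lerP t s) => ts; case: (lerP t _) => ts' /=; lra.
Qed.

(** Reindexing the [flip j x] half of [ltf_sensitive_sign] by [flip j] makes it a copy of the other
    half. What remains is twice the correlation of the gate with [L], whose squares sum to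
    [n * 2 ^ n]. *)
Lemma ltf_total_sensitivity (R : realType) (I : finType) (g : gate (LTF R) I) :
  \sum_j \sum_(x : {ffun I -> bool})
      (gate_eval g x != gate_eval g (flip j x))%:R
    <= 2 * Num.sqrt #|I|%:R * 2 ^+ #|I| :> R.
Proof.
pose a j : R := (-1) ^+ (0 <= ltf_weight g j)%R.
pose L (x : {ffun I -> bool}) := \sum_j a j * (-1) ^+ x j.
have -> : \sum_j \sum_(x : {ffun I -> bool})
      (gate_eval g x != gate_eval g (flip j x))%:R
    = \sum_(x : {ffun I -> bool}) 2 * (gate_eval g x)%:R * L x.
  transitivity (\sum_j \sum_(x : {ffun I -> bool})
      2 * (gate_eval g x)%:R * (a j * (-1) ^+ x j)); last first.
    by rewrite exchange_big; apply: eq_bigr => x _; rewrite mulr_sumr.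
  apply: eq_bigr => j _.
  under eq_bigr => x _ do rewrite ltf_sensitive_sign -/(a j) mulrBl.
  rewrite big_split /= -[X in _ + X](sum_flip j) -big_split /=.
  apply: eq_bigr => x _.
  by rewrite flipK flip_eq signrN; ring.
set n := #|I|.
(* The empty index set is treated apart because the argument below divides by [r]. *)
have [n0|n_gt0] := posnP n.
  have I0 : I -> False by move=> i; move: (fintype0 i n0).
  rewrite [X in X <= _]big1 ?mulr_ge0 ?exprn_ge0 ?sqrtr_ge0 // => x _.
  by rewrite /L big1 ?mulr0 // => i; case: (I0 i).
have r_gt0 : 0 < Num.sqrt n%:R :> R by rewrite sqrtr_gt0 ltr0n.
set r := Num.sqrt _ in r_gt0 *.
have r2 : r ^+ 2 = n%:R by rewrite sqr_sqrtr ?ler0n.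
(* AM-GM: [2 L <= L^2 / r + r] *)
apply: (@le_trans _ _ (\sum_(x : {ffun I -> bool}) (r^-1 * L x ^+ 2 + r))).
  apply: ler_sum => x _.
  have H : 0 <= r^-1 * (L x - r) ^+ 2
    by rewrite mulr_ge0 ?sqr_ge0 ?invr_ge0 ?ltW.
  have E : r^-1 * (L x - r) ^+ 2 = r^-1 * L x ^+ 2 + r - 2 * L x.
    by field; rewrite gt_eqF.
  have H' : 0 <= r^-1 * L x ^+ 2 by rewrite mulr_ge0 ?sqr_ge0 ?invr_ge0 ?ltW.
  case: (gate_eval g x); rewrite ?mulr1 ?mulr0 ?mul0r; lra.
rewrite big_split /= -mulr_sumr sum_sign_sqr sumr_const card_ffun card_bool.
rewrite (eq_bigr (fun=> 1)) => [|i _]; last first.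
  by rewrite -exprM mulnC exprM sqrrN !expr1n.
rewrite sumr_const -/n -r2 -[_ *+ (2 ^ n)%N]mulr_natl natrX.
set N := 2%:R ^+ n.
have -> : r^-1 * (N * r ^+ 2) = r * N by field; rewrite gt_eqF.
lra.
Qed.

(** * Two-dimensional subcubes and the lower bounds for threshold circuits *)

Lemma parity_flip (n : nat) (i : 'I_n) (x : {ffun 'I_n -> bool}) :
  parity (flip i x) = ~~ parity x.
Proof.
rewrite /parity (bigD1 i) //= [in RHS](bigD1 i) //= flip_eq.
rewrite (eq_bigr (fun k => x k : nat)); last by move=> k ki; rewrite flip_neq.
by rewrite !oddD !oddb addNb.
Qed.

(* [h] does not split as a sum of a function of [x i] and a function of [x j] on
   the two-dimensional subcube through [x] in the directions [i] and [j]. *)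
Definition interacts (I : finType) (h : {ffun I -> bool} -> bool) (i j : I)
    (x : {ffun I -> bool}) : bool :=
  (h x + h (flip i (flip j x)) != h (flip i x) + h (flip j x))%N.

(** The weighted sum [S] has equal totals on the two diagonals of the subcube. If one diagonal
    passed the threshold and the other failed it, these totals would lie on different sides of twice
    the threshold. *)
Lemma ltf_not_xor (R : realType) (I J : finType) (g : gate (LTF R) J)
    (h : J -> {ffun I -> bool} -> bool) (i j : I) (x : {ffun I -> bool})
    (F := fun y => gate_eval g (fun v => h v y)) :
  (forall v, ~~ interacts (h v) i j x) ->
  F x = F (flip i (flip j x)) -> F (flip i x) = F (flip j x) ->
  F (flip i x) = F x.
Proof.
move=> hx; rewrite /F /=.
pose S y := \sum_v ltf_weight g v * (h v y)%:R.
rewrite -!/(S _).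
have : S x + S (flip i (flip j x)) = S (flip i x) + S (flip j x).
  rewrite -!big_split; apply: eq_bigr => v _ /=.
  rewrite -!mulrDr -!natrD; congr (_ * _%:R).
  by apply/eqP; exact: (negbNE (hx v)).
case: (lerP _ (S x)) => h1; case: (lerP _ (S (flip i (flip j x)))) => h2 //;
  case: (lerP _ (S (flip i x))) => h3; case: (lerP _ (S (flip j x))) => h4 //;
  lra.
Qed.

(** Without errors or interacting bottom gates, [ltf_not_xor] applies to the output gate, since a
    single variable never interacts when [j != i]; parity would then be unchanged by a flip. *)
Lemma error_or_interaction (R : realType) (n : nat) (C : circuit2 (LTF R) n)
    (i j : 'I_n) (x : {ffun 'I_n -> bool})
    (e := fun y : {ffun 'I_n -> bool} => circuit2_eval C y != parity y) :
  j != i ->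
  (1 <= e x + e (flip i x) + e (flip j x) + e (flip i (flip j x))
      + \sum_(k < bottom_size C) interacts (gate_eval (bottom_gate C k)) i j x)%N.
Proof.
move=> ji; case: posnP => // /eqP; rewrite !addn_eq0 !eqb0 !negbK sum_nat_eq0.
case/andP=> /andP[/andP[/andP[/eqP e1 /eqP e2] /eqP e3] /eqP e4] /forallP e5.
pose h (v : 'I_n + 'I_(bottom_size C)) (y : {ffun 'I_n -> bool}) :=
  match v with inl k => y k | inr k => gate_eval (bottom_gate C k) y end.
have hx v : ~~ interacts (h v) i j x.
  case: v => [k|k] /=; last by have := e5 k; rewrite eqb0.
  rewrite /interacts /= negbK !ffunE.
  case: (eqVneq k i) => [->|_]; last by case: (x k); case: (k == j).
  by rewrite (eq_sym i j) (negPf ji); case: (x i).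
have := ltf_not_xor (g := top_gate C) hx.
rewrite -![gate_eval _ _]/(circuit2_eval C _) e1 e2 e3 e4 !parity_flip negbK.
by move=> /(_ erefl erefl) /esym; case: parity.
Qed.

(** An interaction means that the gate changes differently along the two [j]-edges of the subcube,
    so it changes along at least one. With weight 0 at [i] these edges look the same. *)
Lemma ltf_interacts (R : realType) (I : finType) (g : gate (LTF R) I) (i j : I)
    (x : {ffun I -> bool})
    (s := fun y : {ffun I -> bool} => gate_eval g y != gate_eval g (flip j y)) :
  (interacts (gate_eval g) i j x
     <= (ltf_weight g i != 0)%R * (s x + s (flip i x)))%N.
Proof.
cbv beta delta [interacts s]; rewrite (flipC i j).
case: (eqVneq (ltf_weight g i) 0%R) => [wi|_].
  have E (y : {ffun I -> bool}) : gate_eval g (flip i y) = gate_eval g y.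
    by rewrite /= ltf_sum_flip wi mul0r addr0.
  by rewrite (flipC j i) !E eqxx.
rewrite mul1n; move: (gate_eval g x) (gate_eval g (flip i x)).
by move: (gate_eval g (flip j x)) (gate_eval g (flip j (flip i x))); do 4!case.
Qed.

(* Averaging over all the subcubes with directions [i <> j]. *)
Lemma bottom_wires_lower_bound (R : realType) (n : nat)
    (C : circuit2 (LTF R) n) :
  agrees99 (circuit2_eval C) ->
  (n * n.-1)%:R * (24 / 25)
    <= 4 * Num.sqrt n%:R
       * (\sum_(k < bottom_size C) gate_wires (bottom_gate C k))%:R :> R.
Proof.
move=> agree; pose X := {ffun 'I_n -> bool}.
pose e (y : X) := circuit2_eval C y != parity y.
pose g k := bottom_gate C k.
pose S k j : R :=
  \sum_(x : X) (gate_eval (g k) x != gate_eval (g k) (flip j x))%:R.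
have N_gt0 : 0 < 2 ^+ n :> R by rewrite exprn_gt0 ?ltr0n.
pose E (y : X) : R := (e y)%:R.
have err : 25 * \sum_x E x <= 4^-1 * 2 ^+ n :> R.
  have cE : #|{: X}| = (2 ^ n)%N by rewrite card_ffun card_bool card_ord.
  move: agree; rewrite /agrees99 -/X cE.
  set A := [set x : X | _]%SET => H.
  have : (#|A| + \sum_x e x = 2 ^ n)%N.
    rewrite -cE -(cardsC A) -[in RHS](sum1_card (mem (~: A)%SET)).
    rewrite [in RHS]big_mkcond.
    by congr addn; apply: eq_bigr => x _; rewrite !inE /e; case: eqP.
  have -> : 2 ^+ n = (2 ^ n)%N%:R :> R by rewrite natrX.
  rewrite /E -natr_sum => cntE; have : (100 * \sum_x e x <= 2 ^ n)%N by lia.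
  rewrite -(ler_nat R) natrM; lra.
have flip_err i j : \sum_x E (flip i (flip j x)) = \sum_x E x.
  by rewrite (sum_flip j (fun x => E (flip i x))) (sum_flip i E).
(* Each of the four points runs over the whole cube with [x], so errors account for at most 4/100 of
   the subcubes. *)
have pair i j : j != i ->
    24 / 25 * 2 ^+ n <= \sum_k (ltf_weight (g k) i != 0)%R%:R * (2 * S k j).
  move=> ji.
  have : \sum_(x : X) 1 <= \sum_(x : X)
     (E x + E (flip i x) + E (flip j x) + E (flip i (flip j x))
      + \sum_k (interacts (gate_eval (g k)) i j x)%:R) :> R.
    apply: ler_sum => x _.
    by rewrite /E -natr_sum -!natrD ler1n; exact: error_or_interaction.
  rewrite sumr_const card_ffun card_bool card_ord natrX !big_split /=.
  rewrite (sum_flip i E) (sum_flip j E).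
  rewrite (flip_err i j).
  rewrite exchange_big /= => H1.
  have H2 : \sum_k \sum_(x : X) (interacts (gate_eval (g k)) i j x)%:R
      <= \sum_k (ltf_weight (g k) i != 0)%R%:R * (2 * S k j).
    apply: ler_sum => k _.
    rewrite [2 * S k j]mulr_natl mulr2n -[X in _ * (_ + X)](sum_flip i).
    rewrite -big_split mulr_sumr.
    apply: ler_sum => x _ /=.
    by rewrite -natrD -natrM ler_nat ltf_interacts.
  lra.
have : \sum_(i < n) \sum_(j < n | j != i) (24 / 25 * 2 ^+ n) <=
    \sum_(i < n) \sum_(j < n) \sum_k (ltf_weight (g k) i != 0)%R%:R * (2 * S k j).
  (* The terms [j = i] are nonnegative; adding them completes the total sensitivity of each gate. *)
  apply: ler_sum => i _; rewrite [leRHS](bigD1 i) //= -[leLHS]add0r lerD //.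
    apply: sumr_ge0 => k _; rewrite !mulr_ge0 ?ler0n //.
    by apply: sumr_ge0 => x _; rewrite ler0n.
  by apply: ler_sum => j; exact: pair.
rewrite (eq_bigr (fun=> (24 / 25 * 2 ^+ n) *+ n.-1)); last first.
  by move=> i _; rewrite sumr_const cardC1 card_ord.
rewrite sumr_const card_ord -mulrnA -[leLHS]mulr_natl => H.
rewrite mulrA in H; rewrite -(ler_pM2r N_gt0) mulnC.
apply: le_trans H _.
have -> : \sum_(i < n) \sum_(j < n) \sum_k (ltf_weight (g k) i != 0)%R%:R * (2 * S k j)
   = \sum_k (gate_wires (g k))%:R * (2 * \sum_(j < n) S k j).
  transitivity (\sum_(i < n) \sum_k \sum_(j < n)
     (ltf_weight (g k) i != 0)%R%:R * (2 * S k j)).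
    by apply: eq_bigr => i _; rewrite exchange_big.
  rewrite exchange_big; apply: eq_bigr => k _ /=.
  have -> : (gate_wires (g k))%:R
      = \sum_(i < n) (ltf_weight (g k) i != 0)%R%:R :> R.
    rewrite /= -sum1_card natr_sum big_mkcond; apply: eq_bigr => i _.
    by rewrite inE; case: eqP.
  by rewrite mulr_suml; apply: eq_bigr => i _; rewrite !mulr_sumr.
rewrite natr_sum !mulr_sumr mulr_suml; apply: ler_sum => k _.
have := ltf_total_sensitivity (g k); rewrite card_ord -/(S k) => H.
have := ler_wpM2l (ler0n R (2 * gate_wires (g k))) H.
by rewrite natrM; lra.
Qed.

Lemma gate_wires_LTF_le (R : realType) (I : finType) (g : gate (LTF R) I) :
  (gate_wires g <= #|I|)%N.
Proof. exact: max_card. Qed.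

Lemma ltf_circuit_lower_bounds (R : realType) (n : nat)
    (C : circuit2 (LTF R) n) :
  (2 <= n)%N -> agrees99 (circuit2_eval C) ->
  (10^-1 * Num.sqrt n%:R <= (gates C)%:R :> R) /\
  (10^-1 * (n%:R * Num.sqrt n%:R) <= (wires C)%:R :> R).
Proof.
move=> n_ge2 /bottom_wires_lower_bound.
set W := (\sum_(k < _) _)%N; set r : R := Num.sqrt n%:R => bound.
have n_gt0 : 0 < n%:R :> R by rewrite ltr0n; lia.
have r_gt0 : 0 < r by rewrite sqrtr_gt0.
have r2 : r * r = n%:R by rewrite -expr2 sqr_sqrtr ?ltW.
have Wn : (W <= n * bottom_size C)%N.
  have -> : (n * bottom_size C = \sum_(k < bottom_size C) #|'I_n|)%N.
    by rewrite sum_nat_const !card_ord mulnC.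
  by apply: leq_sum => k _; exact: gate_wires_LTF_le.
(* Together with [bound] this gives [W >= 3/25 * n * r], which exceeds the claimed 1/10. *)
have nn : (n * n <= 2 * (n * n.-1))%N.
  by clear -n_ge2; case: n n_ge2 => // n; nia.
have W_ge : 10^-1 * (n%:R * r) <= W%:R.
  rewrite -(ler_pM2r r_gt0) -mulrA -mulrA r2.
  move: nn; rewrite -(ler_nat R) !natrM => nn.
  rewrite natrM in bound; have := mulr_gt0 n_gt0 n_gt0; lra.
split; last first.
  by rewrite /wires natrD -/W (le_trans W_ge) // lerDl ler0n.
(* A bottom gate has at most [n] wires, so the wire bound divided by [n] bounds the gates. *)
rewrite /gates -(ler_pM2l n_gt0) mulrCA; apply: le_trans W_ge _.
by rewrite -natrM ler_nat (leq_trans Wn) // leq_mul2l leqnSn orbT.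
Qed.

(** * Majority gates as threshold gates *)

(* A connection [(Some i, b)] carries the vote [(-1)^b (2 x_i - 1)], and
   [(None, b)] the vote [- (-1)^b]. *)
Definition ltf_of_maj (R : realType) (B : nat) (I : finType)
    (g : gate (MAJ B) I) : gate (LTF R) I :=
  LtfGate (fun i => \sum_(a <- maj_inputs g | a.1 == Some i) 2 * (-1) ^+ a.2)
    (\sum_(a <- maj_inputs g) (-1) ^+ a.2).

(** Votes minus threshold agree connection by connection, as 2(x xor b) - 1 = (-1)^b (2x - 1). *)
Lemma ltf_of_majE (R : realType) (B : nat) (I : finType) (g : gate (MAJ B) I)
    (x : I -> bool) :
  gate_eval (ltf_of_maj R g) x = gate_eval g x.
Proof.
rewrite /= -(ler_nat R) -[LHS]subr_ge0 -[RHS]subr_ge0; congr (0 <= _).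
rewrite natrM -sum1_count -sum1_size !natr_sum [in RHS]big_mkcond mulr_sumr.
rewrite -sumrB.
rewrite (eq_bigr (fun i => \sum_(a <- maj_inputs g)
    (if a.1 == Some i then 2 * (-1) ^+ a.2 * (x i)%:R else 0))); last first.
  by move=> i _; rewrite big_mkcond mulr_suml; apply: eq_bigr => a _;
    case: ifP; rewrite ?mul0r.
rewrite exchange_big -sumrB; apply: eq_bigr => -[[i|] b] _ /=.
  rewrite (bigD1 i) //= eqxx big1 ?addr0 => [|j ji]; last first.
    by case: eqP => // -[ij]; rewrite ij eqxx in ji.
  by rewrite /signed_value /=; case: (x i); case: b => /=;
    rewrite ?expr0 ?expr1; lra.
rewrite big1 // /signed_value /=; case: b => /=; rewrite ?expr0 ?expr1; lra.
Qed.

(** A nonzero weight at [i] requires some connection to [i]; repetitions and constants only enlarge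
    the right-hand side. *)
Lemma gate_wires_ltf_of_maj (R : realType) (B : nat) (I : finType)
    (g : gate (MAJ B) I) :
  (gate_wires (ltf_of_maj R g) <= gate_wires g)%N.
Proof.
rewrite /= -(size_map fst); set s := [seq _ | _ <- _].
have : (size (pmap id s) <= size s)%N by rewrite size_pmap count_size.
apply: leq_trans; apply: leq_trans (card_size _); apply: subset_leq_card.
apply/fintype.subsetP => i; rewrite inE mem_pmap map_id; apply: contraR => si.
rewrite big_seq_cond big1 // => a /andP[ag /eqP ai]; case/negP: si.
by rewrite -ai map_f.
Qed.

Definition ltf_circuit_of_maj (R : realType) (B n : nat)
    (C : circuit2 (MAJ B) n) : circuit2 (LTF R) n :=
  Circuit2 (fun j => ltf_of_maj R (bottom_gate C j)) (ltf_of_maj R (top_gate C)).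

Lemma ltf_circuit_of_majE (R : realType) (B n : nat) (C : circuit2 (MAJ B) n) :
  circuit2_eval (ltf_circuit_of_maj R C) = circuit2_eval C.
Proof.
apply/funext => x; rewrite /circuit2_eval ltf_of_majE; congr gate_eval.
by apply/funext => -[i|j] //; exact: ltf_of_majE.
Qed.

Lemma maj_circuit_lower_bounds (R : realType) (B n : nat)
    (C : circuit2 (MAJ B) n) :
  (2 <= n)%N -> agrees99 (circuit2_eval C) ->
  (10^-1 * Num.sqrt n%:R <= (gates C)%:R :> R) /\
  (10^-1 * (n%:R * Num.sqrt n%:R) <= (wires C)%:R :> R).
Proof.
move=> n2; rewrite -(ltf_circuit_of_majE R) => /(ltf_circuit_lower_bounds n2).
case=> hg hw; split=> //; apply: le_trans hw _; rewrite ler_nat.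
by apply: leq_add; [apply: leq_sum => j _|]; exact: gate_wires_ltf_of_maj.
Qed.

(** * Majority circuits for parity on a window of weights *)

Lemma exists_maj_at_least (B n k : nat) :
  (0 < n <= B)%N -> (k <= n)%N ->
  exists g : gate (MAJ B) 'I_n, (gate_wires g <= 2 * n)%N /\
    forall x, gate_eval g x = (k <= \sum_i x i)%N.
Proof.
move=> /andP[n_gt0 nB] kn.
pose lits := [seq (Some i, false) | i <- enum 'I_n].
(* By truncated subtraction at most one block of constants is nonempty: false ones raise the
   threshold to [k], true ones lower it. As [k <= n], there are at most [n] of them. *)
pose s := lits ++ nseq (2 * k - n) (None, false)
  ++ nseq (n - 2 * k) (None, true).
have mult a : (count_mem a s <= B)%N.
  rewrite !count_cat !count_nseq; case: a => -[i|] b /=.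
    rewrite !mul0n !addn0 (leq_trans _ (leq_trans n_gt0 nB)) // count_uniq_mem.
      exact: leq_b1.
    by rewrite map_inj_uniq ?enum_uniq // => ? ? [].
  rewrite (_ : count_mem _ lits = 0)%N; last first.
    rewrite count_map; apply/eqP.
    by rewrite -leqn0 leqNgt -has_count; apply/hasPn.
  apply: leq_trans nB; rewrite add0n; case: b => /=; rewrite ?mul0n ?mul1n; lia.
exists (MajGate mult); split=> [|x] /=.
  rewrite !size_cat !size_nseq size_map size_enum_ord; lia.
rewrite !size_cat !size_nseq size_map size_enum_ord !count_cat !count_nseq /=.
have -> : count (signed_value x) lits = (\sum_i x i)%N.
  rewrite count_map -sum1_count big_mkcond big_enum.
  by apply: eq_bigr => i _; rewrite /= /signed_value /= addbF; case: (x i).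
rewrite /signed_value /= mul0n mul1n add0n; apply/idP/idP; lia.
Qed.

Lemma exists_maj_alternating (B n m : nat) :
  (0 < B)%N ->
  exists g : gate (MAJ B) ('I_n + 'I_m)%type, gate_wires g = m.+1 /\
    forall v, gate_eval g v = (m < 2 * \sum_(j < m) (v (inr j) (+) odd j))%N.
Proof.
move=> B_gt0.
(* The constant false makes the majority strict. *)
pose s := (None, false) ::
  [seq (Some (inr j : 'I_n + 'I_m), odd j) | j <- enum 'I_m].
have mult a : (count_mem a s <= B)%N.
  rewrite (leq_trans _ B_gt0) // count_uniq_mem ?leq_b1 //=.
  rewrite map_inj_uniq ?enum_uniq ?andbT => [|? ? []//].
  by apply/mapP => -[].
exists (MajGate mult); split=> [|v] /=; first by rewrite size_map size_enum_ord.
rewrite size_map size_enum_ord /signed_value /= add0n; congr (_ < 2 * _)%N.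
rewrite count_map -sum1_count big_mkcond big_enum; apply: eq_bigr => i _ /=.
by case: (_ (+) _).
Qed.

(** Each pair of positions [2i], [2i+1] contributes 1, except that a pair split by the end of the
    prefix contributes 2; this happens exactly when [u] is odd and below [2 * q]. *)
Lemma sum_alternating_prefix (u q : nat) :
  (\sum_(j < 2 * q) ((j < u) (+) odd j) = q + odd (minn u (2 * q)))%N.
Proof.
elim: q => [|q IHq]; first by rewrite big_ord0 muln0 minn0.
rewrite mulnS -[(2 + _)%N]/(2 * q).+2 !big_ord_recr /= IHq !oddM /=.
have [uq|uq] := leqP u (2 * q).
  have -> : ((2 * q).+1 < u)%N = false by lia.
  by rewrite (minn_idPl _) /=; lia.
rewrite oddM /=.
have [uq1|uq1] := leqP u (2 * q).+1.
  have -> : u = (2 * q).+1 by lia.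
  by rewrite (minn_idPl _) //= oddM /=; lia.
by rewrite (minn_idPr _) //= oddM /=; lia.
Qed.

(** The gates testing weight at least [a + j + 1] fire on a prefix of length [t - a]. Their
    alternating count exceeds [q] iff [t - a] is odd, that is, iff [t] is odd, [a] being even. *)
Lemma exists_window_circuit (B n a q : nat) :
  (0 < n <= B)%N -> ~~ odd a -> (a + 2 * q <= n)%N ->
  exists C : circuit2 (MAJ B) n,
    [/\ gates C = (2 * q).+1, (wires C <= 2 * q * (2 * n) + (2 * q).+1)%N &
        forall x : 'I_n -> bool, (a <= \sum_i x i <= a + 2 * q)%N ->
          circuit2_eval C x = parity x].
Proof.
move=> nB a_even aqn.
have /fin_all_exists[bot botP] (j : 'I_(2 * q)) :=
  exists_maj_at_least nB
    (leq_trans (leq_add (leqnn a) (ltn_ord j)) aqn : (a + j.+1 <= n)%N).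
have [n_gt0 n_leB] := andP nB.
have [top [topW topE]] :=
  exists_maj_alternating n (2 * q) (leq_trans n_gt0 n_leB).
exists (Circuit2 bot top); split=> [//||x /andP[xa xq]].
  rewrite /wires [top_gate _]/= topW leq_add2r.
  have -> : (2 * q * (2 * n) = \sum_(j < 2 * q) 2 * n)%N.
    by rewrite sum_nat_const card_ord.
  by apply: leq_sum => j _; case: (botP j).
rewrite /circuit2_eval [top_gate _]/= topE [bottom_gate _]/=.
set t := (\sum_i x i)%N in xa xq *.
rewrite (eq_bigr (fun j : 'I__ => (j < t - a)%N (+) odd j : nat)); last first.
  move=> j _; rewrite (botP j).2 -/t; congr (nat_of_bool (_ (+) _)).
  by apply/idP/idP; lia.
rewrite sum_alternating_prefix (minn_idPl _) ?leq_subLR //.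
by rewrite oddB // (negPf a_even) addbF /parity -/t; case: odd; lia.
Qed.

(** By [sum_sign_sqr] with unit coefficients the squares of [n - 2|x|] sum to [n * 2 ^ n], and every
    counted point contributes at least [c ^ 2]. *)
Lemma chebyshev_weight (n c : nat) :
  (c ^ 2 * #|[set x : {ffun 'I_n -> bool} |
       ~~ (n <= 2 * \sum_i x i + c)%N || ~~ (2 * \sum_i x i <= n + c)%N]%SET|
     <= n * 2 ^ n)%N.
Proof.
rewrite -(ler_nat int) [in leRHS]natrM natrX mulrC.
have := sum_sign_sqr (fun=> 1 : int) (I := 'I_n).
rewrite sumr_const card_ord expr1n => <-.
rewrite -sum1_card mulnC big_distrl natr_sum big_mkcond /=.
apply: ler_sum => x _; rewrite inE mul1n.
have -> : \sum_i 1 * (-1) ^+ x i = n%:R - 2 * (\sum_i x i)%N%:R :> int.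
  rewrite natr_sum mulr_sumr -[n in n%:R]card_ord -sumr_const -sumrB.
  by apply: eq_bigr => i _; case: (x i).
by set t := (\sum_i x i)%N; case: ifP => [/orP|_]; [case|]; nia.
Qed.

Lemma exists_maj_circuit (R : realType) (B n : nat) :
  (400 <= n <= B)%N ->
  exists C : circuit2 (MAJ B) n,
    [/\ agrees99 (circuit2_eval C),
        (gates C)%:R <= 25 * Num.sqrt n%:R :> R &
        (wires C)%:R <= 75 * (n%:R * Num.sqrt n%:R) :> R].
Proof.
case/andP=> n_ge nB.
set r : R := Num.sqrt n%:R.
have r_ge0 : 0 <= r by rewrite sqrtr_ge0.
have r2 : r ^+ 2 = n%:R by rewrite sqr_sqrtr.
have /andP[] := truncn_itv r_ge0; set s := Num.truncn r => sr rs.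
have s2n : (s ^ 2 <= n)%N.
  by rewrite -(ler_nat R) natrX -r2 ler_sqr ?nnegrE.
have ns2 : (n <= s.+1 ^ 2)%N.
  by rewrite -(ler_nat R) natrX -r2 ler_sqr ?nnegrE // ltW.
have r_ge1 : 1 <= r by rewrite -sqrtr1 ler_wsqrtr // ler1n; lia.
(* Chosen so that [(2 * h) ^ 2 = 100 * s.+1 ^ 2 >= 100 * n], which leaves at most 1% of the inputs
   outside the window. *)
pose h := (5 * s.+1)%N.
have h_le : (2 * h + 9 <= n)%N by rewrite /h; nia.
(* The window starts at [n./2 - h] rounded down to an even number; taking [h.+2] for its half-length
   absorbs the roundings. *)
pose a := (2 * ((n./2 - h)./2))%N.
have n2 := odd_double_half n; have a2 := odd_double_half (n./2 - h).
have [] := @exists_window_circuit B n a h.+2.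
- by rewrite nB andbT; lia.
- by rewrite /a oddM.
- by rewrite /a; lia.
move=> C [gC wC CE]; exists C.
have gR : (2 * h.+2).+1%:R <= 25 * r.
  have -> : (2 * h.+2).+1%:R = 10 * s%:R + 15 :> R.
    by rewrite -natrM -natrD; congr _%:R; rewrite /h; lia.
  lra.
split; [|by rewrite gC|].
  pose X := {ffun 'I_n -> bool}.
  have := chebyshev_weight n (2 * h); set bad := [set x | _]%SET => cheb.
  have cE : #|{: X}| = (2 ^ n)%N by rewrite card_ffun card_bool card_ord.
  rewrite /agrees99 -/X; set good := [set x | _]%SET.
  have sub : (#|~: bad| <= #|good|)%N.
    apply/subset_leq_card/fintype.subsetP => x.
    rewrite !inE negb_or !negbK => /andP[x1 x2]; apply/eqP/CE.
    by rewrite /a; lia.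
  have := cardsC bad; rewrite cE => badC.
  have : (100 * #|bad| <= 2 ^ n)%N.
    rewrite -(leq_pmul2l (_ : 0 < n)%N); last by lia.
    apply: leq_trans cheb; rewrite mulnA leq_mul2r; apply/orP; right.
    by rewrite /h mulnA expnMn mulnC leq_mul.
  by lia.
apply: (@le_trans _ _ ((2 * h.+2).+1 * (3 * n))%N%:R).
  by rewrite ler_nat (leq_trans wC) //; nia.
rewrite natrM; apply: le_trans (ler_wpM2r (ler0n _ _) gR) _.
by rewrite natrM; lra.
Qed.

(** * Infima and asymptotics *)

(** The witness [x] bounds the infimum from above and makes the set nonempty, which rules out the
    default value of [inf]. *)
Lemma inf_image_itv (R : realType) (T : Type) (P : set T) (f : T -> R) (b c : R)
    (x : T) :
  P x -> f x <= c -> (forall y, P y -> b <= f y) ->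
  b <= inf [set f y | y in P] <= c.
Proof.
move=> Px fx bP; apply/andP; split.
  by apply: lb_le_inf => [|_ [y Py <-]]; [exists (f x), x | exact: bP].
apply: le_trans fx; apply: ge_inf; last by exists x.
by exists b => _ [y Py <-]; exact: bP.
Qed.

Lemma eqTheta_near (R : realType) (f g : nat -> R) (b c : R) :
  0 < b -> 0 < c -> (forall n, 0 <= g n) ->
  (\forall n \near \oo, b * g n <= f n <= c * g n) ->
  f =Theta_\oo g.
Proof.
move=> b_gt0 c_gt0 g_ge0 fg; rewrite eqThetaE; apply/asboolP.
exists (b, c); first by rewrite /= b_gt0 c_gt0.
apply: filterS fg => n /andP[bf fc] /=.
by rewrite !ger0_norm // (le_trans _ bf) // mulr_ge0 // ltW.
Qed.

Lemma powR_3half (R : realType) (n : nat) :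
  n%:R `^ (3 / 2) = n%:R * Num.sqrt n%:R :> R.
Proof.
have -> : 3 / 2 = 1 + 2^-1 :> R by lra.
rewrite powRD; last by apply/implyP => /eqP; lra.
by rewrite powRr1 ?ler0n // powR12_sqrt ?ler0n.
Qed.

Theorem theorem1p5 (R : realType) :
  (forall d : nat, (1 <= d)%N ->
     (fun n => gate_complexity R (MAJ (n ^ d)) n)
       =Theta_\oo (fun n => Num.sqrt n%:R) /\
     (fun n => wire_complexity R (MAJ (n ^ d)) n)
       =Theta_\oo (fun n => n%:R `^ (3 / 2))) /\
  (exists2 c : R, 0 < c &
     \forall n \near \oo, forall C : circuit2 (LTF R) n,
       agrees99 (circuit2_eval C) -> c * Num.sqrt n%:R <= (gates C)%:R) /\
  (exists2 c : R, 0 < c &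
     \forall n \near \oo, forall C : circuit2 (LTF R) n,
       agrees99 (circuit2_eval C) -> c * n%:R `^ (3 / 2) <= (wires C)%:R).
Proof.
have c_gt0 : 0 < 10^-1 :> R by lra.
split; [move=> d d_gt0|split].
(* Since [d >= 1], the multiplicity bound [n ^ d] admits the up to [n] repeated constants of a
   bottom gate. *)
- have nB n : (400 <= n)%N -> (400 <= n <= n ^ d)%N.
    by move=> n_ge; rewrite n_ge -[leqLHS]expn1 leq_exp2l //; lia.
  split.
    apply: (@eqTheta_near R _ _ 10^-1 25) => //.
    exists 400%N => // n n_ge.
    have [C [C99 gC _]] := exists_maj_circuit R (nB n n_ge).
    apply: (inf_image_itv (x := C)) => // C'.
    by case/(maj_circuit_lower_bounds R (leq_trans _ n_ge)).
  apply: (@eqTheta_near R _ _ 10^-1 75) => //.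
  exists 400%N => // n n_ge.
  have [C [C99 _ wC]] := exists_maj_circuit R (nB n n_ge).
  rewrite powR_3half; apply: (inf_image_itv (x := C)) => // C'.
  by case/(maj_circuit_lower_bounds R (leq_trans _ n_ge)).
- exists 10^-1 => //; exists 2%N => // n n_ge2 C.
  by case/(ltf_circuit_lower_bounds n_ge2).
- exists 10^-1 => //; exists 2%N => // n n_ge2 C.
  by rewrite powR_3half => /(ltf_circuit_lower_bounds n_ge2)[].
Qed.
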